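(* Let $R:V^{\otimes2}\to V^{\otimes 2}$, $\dim V=N$, be a skew-invertible involutive (resp. Hecke) symmetry, and let $R(u,v)$ be the corresponding rational (resp. trigonometric) current braiding $$R(u,v)=R-\frac{I}{u-v}\qquad\Big(\text{resp. } R(u,v)=R-\frac{(q-q^{-1})\,u\,I}{u-v}\Big).$$ Consider the quantum double of Zamolodchikov–Faddeev type associated with $R(u,v)$, generated by the currents $x_i(u)$ and $x^j(u)$, $1\le i,j\le N$, and let $L(u)=\|l_i^j(u)\|_{1\le i,j\le N}$ with $l_i^j(u)=x_i(u)\,x^j(u)$. Then $$R_{12}(u,v)L_1(u)R_{12}L_1(v)-L_1(v)R_{12}L_1(u)R_{12}(u,v)=\big(R_{12}L_1(u)-L_1(u)R_{12}\big)\,\delta(u-v),$$ where $L_1(u)=L(u)\otimes I$.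
   Context: Summation over repeated indices is understood. $V$ is a complex vector space with basis indexed by $1,\dots,N$, and $R(x_i\otimes x_j)=R_{ij}^{kl}x_k\otimes x_l$. **Symmetries.** $R$ satisfies the braid relation $R_{12}R_{23}R_{12}=R_{23}R_{12}R_{23}$. It is an involutive symmetry if $R^2=I$, and a Hecke symmetry if $(R-qI)(R+q^{-1}I)=0$ with $q\ne0,\pm1$. In the involutive (rational) case one sets $q=1$ in the formulae below. Skew-invertible means that there is $\Psi$ with $R_{ij}^{kl}\Psi_{lm}^{jn}=\delta_m^k\delta_i^n$. **Normalizing function.** $g(u,v)=1-\frac{1}{u-v}$ in the rational case and $g(u,v)=q-\frac{(q-q^{-1})u}{u-v}$ in the trigonometric case. **Quantum double of Zamolodchikov–Faddeev type.** It is the associative unital algebra generated by the Fourier coefficients of the formal currents $x_i(u)=\sum_{m\in\mathbb{Z}}x_i[m]u^{-m-1}$ and $x^i(u)=\sum_{m\in\mathbb{Z}}x^i[m]u^{-m-1}$, with the defining relations $$g(u,v)\,x_i(v)\,x_j(u)=R_{ij}^{kl}(u,v)\,x_k(u)\,x_l(v),$$ $$g(u,v)\,x^i(u)\,x^j(v)=R_{lk}^{ji}(u,v)\,x^k(v)\,x^l(u),$$ $$x^a(u)\,R_{ai}^{bj}\,x_b(v)=q^{-1}\,x_i(v)\,x^j(u)+\delta_i^j\,\delta(u-v),$$ where $R$ without arguments is the constant symmetry and $\delta(u-v)=\sum_{p\in\mathbb{Z}}\frac{v^p}{u^{p+1}}$. **Expansion in modes.** To express the first two groups of relations through Fourier coefficients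 one uses $\frac1{u-v}=\sum_{p\ge0}\frac{v^p}{u^{p+1}}$ and half-currents. These are $x_i(u)=x_i^+(u)+x_i^-(u)$ with $x_i^+(u)=\sum_{m<0}x_i[m]u^{-m-1}$ and $x_i^-(u)=\sum_{m\ge0}x_i[m]u^{-m-1}$, and similarly $x^i(u)=x^i_+(u)+x^i_-(u)$. The half-currents satisfy $g(u,v)x_i^{\pm}(v)x_j^{\pm}(u)=R_{ij}^{kl}(u,v)x_k^{\pm}(u)x_l^{\pm}(v)$ and $g(u,v)x_i^-(v)x_j^+(u)=R_{ij}^{kl}(u,v)x_k^+(u)x_l^-(v)$, and analogous relations hold for $x^i_\pm(u)$. The relations for the full currents displayed above hold. **Formal meaning of the identity.** The asserted identity is an identity of formal expressions in the currents. The product $x_i(u)x^j(u)$ is taken formally. The delta-function is used through the rule $x_i(u)x^j(v)\,\delta(u-v)=x_i(v)x^j(u)\,\delta(u-v)=l_i^j(u)\,\delta(u-v)$. The scalar factors $\frac{1}{u-v}\,\delta(u-v)$ (resp. $\frac{(q-q^{-1})u}{u-v}\,\delta(u-v)$) are treated as formal central coefficients. **Matrix conventions.** Lower indices label rows and upper indices label columns: $(MN)_{ij}^{kl}=M_{ij}^{ab}N_{ab}^{kl}$, $(L_1(u))_{ij}^{kl}=l_i^k(u)\delta_j^l$, $R_{12}=\|R_{ij}^{kl}\|$, $R_{12}(u,v)=\|R_{ij}^{kl}(u,v)\|$. Noncommuting entries are multiplied in the order of the matrices. *)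

(* Defs.v *)
From HB Require Import structures.
From mathcomp Require Import all_boot all_order all_algebra.
From mathcomp Require Import boolp reals.
From mathcomp Require Import complex mxtens.

Set Implicit Arguments.
Unset Strict Implicit.
Unset Printing Implicit Defensive.

Import GRing.Theory.
Local Open Scope ring_scope.

(** [ncseries X K] is the algebra K<<X>> of arbitrary (possibly infinite)
    K-linear combinations of words in the letters X.  A word splits in finitely
    many ways, so the product of two series is always defined; this is what
    gives a meaning to the product of two currents at the same point. *)

Definition ncseries (X : Type) (K : comNzRingType) : Type := seq X -> K.

Section NCSeries.
Variables (X : Type) (K : comNzRingType).
Local Notation F := (ncseries X K).
Implicit Types (f g h : F) (w : seq X).

HB.instance Definition _ := gen_eqMixin F.
HB.instance Definition _ := gen_choiceMixin F.

Definition nc_zero : F := fun _ => 0.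
Definition nc_opp f : F := fun w => - f w.
Definition nc_add f g : F := fun w => f w + g w.
Definition nc_one : F := fun w => (nilp w)%:R.
Definition nc_mul f g : F :=
  fun w => \sum_(k < (size w).+1) f (take k w) * g (drop k w).
Definition nc_scale (c : K) f : F := fun w => c * f w.

Fact nc_addA : associative nc_add.
Proof. by move=> f g h; apply: funext => w; rewrite /nc_add addrA. Qed.
Fact nc_addC : commutative nc_add.
Proof. by move=> f g; apply: funext => w; rewrite /nc_add addrC. Qed.
Fact nc_add0 : left_id nc_zero nc_add.
Proof. by move=> f; apply: funext => w; rewrite /nc_add add0r. Qed.
Fact nc_addN : left_inverse nc_zero nc_opp nc_add.
Proof. by move=> f; apply: funext => w; rewrite /nc_add addNr. Qed.

HB.instance Definition _ :=
  GRing.isZmodule.Build F nc_addA nc_addC nc_add0 nc_addN.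

Fact nc_mulA : associative nc_mul.
Proof.
move=> f g h; apply: funext => w; rewrite /nc_mul.
pose n := size w.
pose P (i j : nat) := f (take i w) * g (take (j - i) (drop i w)) * h (drop j w).
transitivity (\sum_(i < n.+1) \sum_(j < n.+1 | (i <= j)%N) P i j).
  apply: eq_bigr => i _; have le_in : (i <= n)%N by rewrite -ltnS.
  have -> : \sum_(j < n.+1 | (i <= j)%N) P i j
          = \sum_(0 <= k < n.+1 - i) P i (k + i)%N.
    by rewrite -(big_geq_mkord i n.+1 xpredT (P i)) -{1}(add0n (i : nat)) big_addn.
  rewrite mulr_sumr subSn // size_drop big_mkord; apply: eq_bigr => k _.
  by rewrite /P addnK drop_drop mulrA.
rewrite (exchange_big_dep xpredT) //=; apply: eq_bigr => j _.
have le_jn : (j <= n)%N by rewrite -ltnS.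
rewrite mulr_suml size_takel // (big_ord_widen n.+1
  (fun i => f (take i (take j w)) * g (drop i (take j w)) * h (drop j w))) //.
apply: eq_big => [i|i le_ij]; first by rewrite ltnS.
by rewrite /P take_drop subnK // take_takel.
Qed.

Fact nc_mul1 : left_id nc_one nc_mul.
Proof.
move=> f; apply: funext => w; rewrite /nc_mul big_ord_recl /=.
rewrite take0 drop0 mul1r big1 ?addr0 // => i _.
by rewrite /nc_one; case: w i => [[]|x w i] //=; rewrite mul0r.
Qed.

Fact nc_mulr1 : right_id nc_one nc_mul.
Proof.
move=> f; apply: funext => w; rewrite /nc_mul big_ord_recr /=.
rewrite take_size drop_size mulr1 big1 ?add0r // => i _.
by rewrite /nc_one /nilp size_drop subn_eq0 leqNgt ltn_ord mulr0.
Qed.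

Fact nc_mulDl : left_distributive nc_mul nc_add.
Proof.
move=> f g h; apply: funext => w; rewrite /nc_mul /nc_add -big_split /=.
by apply: eq_bigr => i _; rewrite mulrDl.
Qed.

Fact nc_mulDr : right_distributive nc_mul nc_add.
Proof.
move=> f g h; apply: funext => w; rewrite /nc_mul /nc_add -big_split /=.
by apply: eq_bigr => i _; rewrite mulrDr.
Qed.

Fact nc_one_neq0 : nc_one != nc_zero.
Proof. by apply/eqP => /(congr1 (@^~ [::])) /eqP; rewrite oner_eq0. Qed.

HB.instance Definition _ := GRing.Zmodule_isNzRing.Build F
  nc_mulA nc_mul1 nc_mulr1 nc_mulDl nc_mulDr nc_one_neq0.

Fact nc_scaleA a b f : nc_scale a (nc_scale b f) = nc_scale (a * b) f.
Proof. by apply: funext => w; rewrite /nc_scale mulrA. Qed.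
Fact nc_scale1 : left_id 1 nc_scale.
Proof. by move=> f; apply: funext => w; rewrite /nc_scale mul1r. Qed.
Fact nc_scaleDr : right_distributive nc_scale +%R.
Proof. by move=> a f g; apply: funext => w; exact: mulrDr. Qed.
Fact nc_scaleDl f : {morph nc_scale^~ f : a b / a + b}.
Proof. by move=> a b; apply: funext => w; exact: mulrDl. Qed.

HB.instance Definition _ := GRing.Zmodule_isLmodule.Build K F
  nc_scaleA nc_scale1 nc_scaleDr nc_scaleDl.

Fact nc_scaleAl a f g : nc_scale a (nc_mul f g) = nc_mul (nc_scale a f) g.
Proof.
apply: funext => w; rewrite /nc_mul /nc_scale.
by rewrite mulr_sumr; apply: eq_bigr => i _; rewrite mulrA.
Qed.

Fact nc_scaleAr a f g : nc_scale a (nc_mul f g) = nc_mul f (nc_scale a g).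
Proof.
apply: funext => w; rewrite /nc_mul /nc_scale.
by rewrite mulr_sumr; apply: eq_bigr => i _; rewrite mulrCA.
Qed.

HB.instance Definition _ := GRing.Lmodule_isLalgebra.Build K F nc_scaleAl.
HB.instance Definition _ := GRing.Lalgebra_isAlgebra.Build K F nc_scaleAr.

End NCSeries.

Section Ideal.
Variables (K : comNzRingType) (A : algType K).

(* The smallest two-sided ideal containing [G]; it is automatically stable
   under scaling by K, since [c *: x = c%:A * x]. *)
Inductive ideal_gen (G : A -> Prop) : A -> Prop :=
| ideal_rel x : G x -> ideal_gen G x
| ideal_0 : ideal_gen G 0
| ideal_add x y : ideal_gen G x -> ideal_gen G y -> ideal_gen G (x + y)
| ideal_mul a x b : ideal_gen G x -> ideal_gen G (a * x * b).

Definition mx_congr (G : A -> Prop) m n (M N : 'M[A]_(m, n)) : Prop :=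
  forall i j, ideal_gen G (M i j - N i j).

End Ideal.

(** The operator R on the tensor square of V is given by its matrix, whose
    rows are the lower indices and whose columns are the upper ones:
    R (x_i (x) x_j) = R_{ij}^{kl} x_k (x) x_l. *)

Section Symmetry.
Variables (C : fieldType) (N : nat).

Definition tentry (T : Type) (M : 'M[T]_(N * N)) (i j k l : 'I_N) : T :=
  M (mxtens_index (i, j)) (mxtens_index (k, l)).

Definition leg12 (M : 'M[C]_(N * N)) : 'M[C]_(N * N * N) :=
  tensmx M (1%:M : 'M_N).
Definition leg23 (M : 'M[C]_(N * N)) : 'M[C]_(N * N * N) :=
  castmx (mulnA N N N, mulnA N N N) (tensmx (1%:M : 'M_N) M).

Definition braid_relation (M : 'M[C]_(N * N)) : Prop :=
  leg12 M *m leg23 M *m leg12 M = leg23 M *m leg12 M *m leg23 M.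

Definition involutive_symmetry (M : 'M[C]_(N * N)) : Prop :=
  braid_relation M /\ M *m M = 1%:M.

Definition Hecke_symmetry (q : C) (M : 'M[C]_(N * N)) : Prop :=
  [/\ braid_relation M, (M - q%:M) *m (M + q^-1%:M) = 0
    & [/\ q != 0, q != 1 & q != -1]].

Definition skew_invertible (M : 'M[C]_(N * N)) : Prop :=
  exists Psi : 'M[C]_(N * N), forall i k m n : 'I_N,
    \sum_j \sum_l tentry M i j k l * tentry Psi l m j n
    = (m == k)%:R * (i == n)%:R.

End Symmetry.

(** The two cases treated in parallel: an involutive symmetry with its rational
    current braiding, or a Hecke symmetry (with parameter q) with its
    trigonometric one. *)

Variant current_type (C : Type) : Type :=
| Rational
| Trigonometric of C.
Arguments Rational {C}.

Definition symmetry_of (C : fieldType) (N : nat) (t : current_type C)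
    (M : 'M[C]_(N * N)) : Prop :=
  match t with
  | Rational => involutive_symmetry M
  | Trigonometric q => Hecke_symmetry q M
  end.

Definition qparam (C : fieldType) (t : current_type C) : C :=
  if t is Trigonometric q then q else 1.

(** The central coefficients form the polynomial ring C(u,v)[delta].  The
    function 1/(u-v) is an element of the field C(u,v); it stands for its
    expansion in the region |u| > |v|, which is an injective ring morphism on
    C[u^+-1, v^+-1, 1/(u-v)].  The symbol delta stands for
    delta(u-v) = \sum_p v^p / u^(p+1).  It has to be a free indeterminate: as
    formal distributions (u-v) delta(u-v) = 0, so in an associative ring where
    u-v is invertible and that equation holds, delta would vanish; the products
    (1/(u-v)) delta(u-v) are formal coefficients subject to no relation. *)

Section Scalars.
Variable C : fieldType.

Definition ratfun : fieldType := {fraction {poly {poly C}}}.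
Definition scal : comUnitRingType := {poly ratfun}.

Definition rconst (c : C) : ratfun := tofrac (c%:P%:P : {poly {poly C}}).
Definition ru : ratfun := tofrac ('X%:P : {poly {poly C}}).
Definition rv : ratfun := tofrac ('X : {poly {poly C}}).

Definition sconst (c : C) : scal := (rconst c)%:P.
Definition delta : scal := 'X.

(* The coefficient of x^a y^b in \sum_p y^p / x^(p+1): the exponents are
   a = - p - 1 and b = p.  By [delta_coefC], delta(u-v) = delta(v-u), which is
   why one symbol serves for both. *)
Definition delta_coef (a b : int) : C := (a == - b - 1)%:R.

Lemma delta_coefC a b : delta_coef a b = delta_coef b a.
Proof.
rewrite /delta_coef; congr (nat_of_bool _)%:R.
by apply/eqP/eqP => ->; rewrite opprB opprK addrC addKr.
Qed.

Variable t : current_type C.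

Definition pole : ratfun :=
  match t with
  | Rational => (ru - rv)^-1
  | Trigonometric q => rconst (q - q^-1) * ru / (ru - rv)
  end.

Definition gfun : scal := (rconst (qparam t) - pole)%:P.

Definition current_braiding (N : nat) (M : 'M[C]_(N * N)) : 'M[scal]_(N * N) :=
  map_mx sconst M - (pole%:P)%:M.

End Scalars.

(* The Fourier coefficients: [(Lo, i, m)] is x_i[m], [(Up, i, m)] is x^i[m]. *)
Variant position := Lo | Up.
Definition position_eqb (p p' : position) : bool :=
  match p, p' with Lo, Lo | Up, Up => true | _, _ => false end.

Definition fmode (N : nat) : Type := (position * 'I_N * int)%type.

Section QuantumDouble.
Variables (C : fieldType) (N : nat).

Definition expr : algType (scal C) := ncseries (fmode N) (scal C).

(* \sum_(m in Z) x[m] z^(-m-1), where x is x_i or x^i. *)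
Definition current (p : position) (i : 'I_N) (z : ratfun C) : expr :=
  fun w => match w with
    | [:: (p', i', m)] =>
        if position_eqb p' p && (i' == i) then (z ^ (- m - 1))%:P else 0
    | _ => 0
    end.

Definition xlo := current Lo.
Definition xup := current Up.

Definition Lmx (z : ratfun C) : 'M[expr]_N := \matrix_(i, j) (xlo i z * xup j z).

Definition L1 (z : ratfun C) : 'M[expr]_(N * N) := tensmx (Lmx z) (1%:M : 'M_N).

Definition mx_expr (M : 'M[scal C]_(N * N)) : 'M[expr]_(N * N) :=
  map_mx (in_alg expr) M.

Variables (t : current_type C) (R : 'M[C]_(N * N)).

Local Notation u := (ru C).
Local Notation v := (rv C).
Local Notation g := (gfun t).
Local Notation Ruv := (current_braiding t R).
Local Notation q := (qparam t).

(* [rel_mixed] is imposed for (u, v) and for (v, u), i.e. also after renaming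
   the formal variables.  For the quadratic relations the renamed ones are
   not needed as generators: they involve 1/(v-u), which C(u,v) identifies
   with -1/(u-v). *)
Variant zf_relator : expr -> Prop :=
| rel_lower (i j : 'I_N) : zf_relator
    (g *: (xlo i v * xlo j u)
     - \sum_k \sum_l tentry Ruv i j k l *: (xlo k u * xlo l v))
| rel_upper (i j : 'I_N) : zf_relator
    (g *: (xup i u * xup j v)
     - \sum_k \sum_l tentry Ruv l k j i *: (xup k v * xup l u))
| rel_mixed (i j : 'I_N) (y z : ratfun C) :
    (y, z) = (u, v) \/ (y, z) = (v, u) -> zf_relator
    (\sum_a \sum_b sconst (tentry R a i b j) *: (xup a y * xlo b z)
     - (sconst q^-1 *: (xlo i z * xup j y) + (i == j)%:R *: (delta C)%:A))
| rel_delta_uv (i j : 'I_N) : zf_relator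
    (delta C *: (xlo i u * xup j v) - delta C *: Lmx u i j)
| rel_delta_vu (i j : 'I_N) : zf_relator
    (delta C *: (xlo i v * xup j u) - delta C *: Lmx u i j).

End QuantumDouble.

(* Main.v *)
Require Import Defs.
From HB Require Import structures.
From mathcomp Require Import all_boot all_order all_algebra.
From mathcomp Require Import boolp reals.
From mathcomp Require Import complex mxtens.

Set Implicit Arguments.
Unset Strict Implicit.
Unset Printing Implicit Defensive.

Import GRing.Theory.
Local Open Scope ring_scope.

(** Each entry of L(z) is a lower current times an upper one, so in the middle
    of L1(y) R12 L1(z) stands x^c(y) R_{cb}^{el} x_e(z), the left-hand side of
    the mixed relation.  Exchanging these two inner currents gives, modulo the
    relations,

      L1(y) R12 L1(z) = q^-1 X(y,z) Y(y,z) + delta L1(u)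

    for (y,z) = (u,v) and for (y,z) = (v,u) ([L1_R_L1]), where X(y,z) is the
    column with entries x_a(y) x_b(z) and Y(y,z) the row with entries
    x^l(y) x^k(z).  The last term is L1(u) in both cases because delta
    identifies u with v.

    In this notation the two quadratic relations read
    R(u,v) X(u,v) = g X(v,u) ([braiding_col2]) and Y(v,u) R(u,v) = g Y(u,v)
    ([row2_braiding]).  Hence R(u,v) L1(u) R12 L1(v) and
    L1(v) R12 L1(u) R(u,v) have the same quartic part q^-1 g X(v,u) Y(u,v), and
    their difference is delta times the commutator of R(u,v) with L1(u).  Since
    R(u,v) differs from R12 by a central multiple of the identity, this is also
    the commutator of R12 with L1(u) ([reflection_of_exchange]). *)

(** * Congruence of matrices modulo a two-sided ideal *)

Section IdealCongruence.
Variables (K : comNzRingType) (A : algType K) (G : A -> Prop).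

Lemma ideal_mull a x : ideal_gen G x -> ideal_gen G (a * x).
Proof. by move=> Gx; rewrite -[a * x]mulr1; apply: ideal_mul. Qed.

Lemma ideal_mulr x b : ideal_gen G x -> ideal_gen G (x * b).
Proof. by move=> Gx; rewrite -[x]mul1r; apply: ideal_mul. Qed.

Lemma ideal_opp x : ideal_gen G x -> ideal_gen G (- x).
Proof. by rewrite -mulN1r; apply: ideal_mull. Qed.

Lemma ideal_sum (I : finType) (F : I -> A) :
  (forall i, ideal_gen G (F i)) -> ideal_gen G (\sum_i F i).
Proof.
by move=> GF; elim/big_ind: _ => // [|x y]; [exact: ideal_0|exact: ideal_add].
Qed.

Lemma mx_congr_refl m n (M : 'M[A]_(m, n)) : mx_congr G M M.
Proof. by move=> i j; rewrite subrr; apply: ideal_0. Qed.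

Lemma mx_congr_sym m n (M P : 'M[A]_(m, n)) : mx_congr G M P -> mx_congr G P M.
Proof. by move=> MP i j; rewrite -opprB; apply: ideal_opp. Qed.

Lemma mx_congr_trans m n (P M Q : 'M[A]_(m, n)) :
  mx_congr G M P -> mx_congr G P Q -> mx_congr G M Q.
Proof.
by move=> MP PQ i j; rewrite -(subrKA (P i j)); apply: ideal_add.
Qed.

Lemma mx_congrD m n (M M' P P' : 'M[A]_(m, n)) :
  mx_congr G M M' -> mx_congr G P P' -> mx_congr G (M + P) (M' + P').
Proof.
by move=> MM PP i j; rewrite !mxE opprD addrACA; apply: ideal_add.
Qed.

Lemma mx_congrB m n (M M' P P' : 'M[A]_(m, n)) :
  mx_congr G M M' -> mx_congr G P P' -> mx_congr G (M - P) (M' - P').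
Proof.
move=> MM PP i j; rewrite !mxE opprD opprK addrACA.
by apply: ideal_add => //; rewrite addrC -opprB; apply: ideal_opp.
Qed.

Lemma mx_congrZ m n (a : A) (M P : 'M[A]_(m, n)) :
  mx_congr G M P -> mx_congr G (a *: M) (a *: P).
Proof. by move=> MP i j; rewrite !mxE -mulrBr; apply: ideal_mull. Qed.

Lemma mx_congr_mull m n p (Q : 'M[A]_(m, n)) (M P : 'M[A]_(n, p)) :
  mx_congr G M P -> mx_congr G (Q *m M) (Q *m P).
Proof.
move=> MP i j; rewrite !mxE -sumrB; apply: ideal_sum => k.
by rewrite -mulrBr; apply: ideal_mull.
Qed.

Lemma mx_congr_mulr m n p (Q : 'M[A]_(n, p)) (M P : 'M[A]_(m, n)) :
  mx_congr G M P -> mx_congr G (M *m Q) (P *m Q).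
Proof.
move=> MP i j; rewrite !mxE -sumrB; apply: ideal_sum => k.
by rewrite -mulrBl; apply: ideal_mulr.
Qed.

(** The entries of A do not commute, so a scalar leaves the right factor of a
    matrix product only because it comes from the central ring K. *)
Lemma central_scalemxAr m n p (c : K) (M : 'M[A]_(m, n)) (P : 'M[A]_(n, p)) :
  M *m (c%:A *: P) = c%:A *: (M *m P).
Proof.
apply/matrixP => i j; rewrite !mxE mulr_sumr; apply: eq_bigr => k _.
by rewrite !mxE !mulr_algl scalerAr.
Qed.

Lemma scale_inner (c : K) (x y z w l l' : A) :
  l = x * y -> l' = z * w -> l * c%:A * l' = x * (c *: (y * z)) * w.
Proof. by move=> -> ->; rewrite mulr_algr -scalerAr -!scalerAl !mulrA. Qed.

(** When S - (c p + b d) and d x w - d l are relators, the left-hand side lies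
    in their ideal.  It records two reductions: of S inside x S w, and then of
    the term b d x w which the first one produces. *)
Lemma contract_inner (b : bool) (c d : K) (x w S p l : A) :
  x * (S - (c *: p + b%:R *: d%:A)) * w + b%:R * (d *: (x * w) - d *: l)
  = x * S * w - (c *: (x * p * w) + b%:R * (d *: l)).
Proof.
rewrite mulrBr mulrBl mulrDr mulrDl -addrA; congr (_ + _).
rewrite !opprD -addrA -scalerAr -scalerAl; congr (_ + _).
case: b; last by rewrite scale0r mulr0 !mul0r oppr0 addr0.
by rewrite scale1r !mul1r mulr_algr -scalerAl addKr.
Qed.

Lemma central_shift_commutator n (c : K) (M P : 'M[A]_n) :
  (M - c%:A%:M) *m P - P *m (M - c%:A%:M) = M *m P - P *m M.
Proof.
rewrite mulmxBl mulmxBr mul_scalar_mx -scalemx1 central_scalemxAr mulmx1.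
by rewrite opprB addrA subrK.
Qed.

(** Multiplied by S, both quartic parts become c f X' Y: the first one through
    X on the left, the second one through Y' on the right.  They cancel, and
    only the d-terms remain. *)
Lemma reflection_of_exchange m n (a c d f : K) (S R L L' : 'M[A]_n)
    (X X' : 'M[A]_(n, m)) (Y Y' : 'M[A]_(m, n)) :
  S = R - a%:A%:M ->
  mx_congr G (L *m R *m L') (c%:A *: (X *m Y) + d%:A *: L) ->
  mx_congr G (L' *m R *m L) (c%:A *: (X' *m Y') + d%:A *: L) ->
  mx_congr G (S *m X) (f%:A *: X') ->
  mx_congr G (Y' *m S) (f%:A *: Y) ->
  mx_congr G (S *m L *m R *m L' - L' *m R *m L *m S)
             (d%:A *: (R *m L - L *m R)).
Proof.
move=> Sshift LRL' L'RL SX YS.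
have -> : R *m L - L *m R = S *m L - L *m S.
  by rewrite Sshift central_shift_commutator.
set quartic := c%:A *: (f%:A *: (X' *m Y)).
have left_part : mx_congr G (S *m L *m R *m L') (quartic + d%:A *: (S *m L)).
  rewrite -!mulmxA [L *m (_ *m _)]mulmxA.
  apply: mx_congr_trans (mx_congr_mull S LRL') _.
  rewrite mulmxDr !central_scalemxAr mulmxA.
  apply: mx_congrD (mx_congr_refl _); apply: mx_congrZ.
  by rewrite scalemxAl; apply: mx_congr_mulr.
have right_part : mx_congr G (L' *m R *m L *m S) (quartic + d%:A *: (L *m S)).
  apply: mx_congr_trans (mx_congr_mulr S L'RL) _.
  rewrite mulmxDl -!scalemxAl -mulmxA.
  apply: mx_congrD (mx_congr_refl _); apply: mx_congrZ.
  by rewrite -central_scalemxAr; apply: mx_congr_mull.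
apply: mx_congr_trans (mx_congrB left_part right_part) _.
by rewrite opprD addrACA subrr add0r -scalerBr; apply: mx_congr_refl.
Qed.

End IdealCongruence.

(** * Matrices indexed by pairs *)

Section DoubleIndices.
Variables (A : nzRingType) (N : nat).
Implicit Types (B : 'M[A]_N).

Lemma sum_mxtens (V : nmodType) (F : 'I_(N * N) -> V) :
  \sum_s F s = \sum_a \sum_b F (mxtens_index (a, b)).
Proof.
rewrite pair_bigA /= (reindex (@mxtens_index N N)) /=.
  by apply: eq_bigr => -[a b].
by exists (@mxtens_unindex N N) => s _; rewrite ?mxtens_indexK ?mxtens_unindexK.
Qed.

Lemma mul_mx_leg1 m (M : 'M[A]_(m, N * N)) B s k l :
  (M *m (B *t (1%:M : 'M_N))) s (mxtens_index (k, l))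
  = \sum_a M s (mxtens_index (a, l)) * B a k.
Proof.
rewrite mxE sum_mxtens; apply: eq_bigr => a _.
rewrite (bigD1 l) //= tensmxE mxE eqxx mulr1 big1 ?addr0 // => b bl.
by rewrite tensmxE mxE (negPf bl) !mulr0.
Qed.

Lemma mul_leg1_mx n (M : 'M[A]_(N * N, n)) B i j s :
  ((B *t (1%:M : 'M_N)) *m M) (mxtens_index (i, j)) s
  = \sum_a B i a * M (mxtens_index (a, j)) s.
Proof.
rewrite mxE sum_mxtens; apply: eq_bigr => a _.
rewrite (bigD1 j) //= tensmxE mxE eqxx mulr1 big1 ?addr0 // => b bj.
by rewrite tensmxE mxE eq_sym (negPf bj) mulr0 mul0r.
Qed.

End DoubleIndices.

(** * The relations of the quantum double in matrix form *)

Section ReflectionEquation.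
Variables (C : fieldType) (N : nat) (t : current_type C) (R : 'M[C]_(N * N)).

Local Notation u := (ru C).
Local Notation v := (rv C).
Local Notation g := (gfun t).
Local Notation expr := (expr C N).
Local Notation Ruv := (mx_expr (current_braiding t R)).
Local Notation R12 := (mx_expr (map_mx (@sconst C) R)).
Local Notation "M ~~~ P" := (mx_congr (zf_relator t R) M P) (at level 70).

Definition xcol2 (y z : ratfun C) : 'cV[expr]_(N * N) :=
  \col_s (xlo (mxtens_unindex s).1 y * xlo (mxtens_unindex s).2 z).

(** The current carrying the second index stands on the left.  This is the
    order in which the mixed relation produces upper currents, since the inner
    exchange moves x^l(y) past x_b(z) to stand before x^k(z), and also the one
    which makes the upper relation a product with the braiding matrix. *)
Definition xrow2 (y z : ratfun C) : 'rV[expr]_(N * N) :=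
  \row_s (xup (mxtens_unindex s).2 y * xup (mxtens_unindex s).1 z).

Lemma mx_exprE (M : 'M[scal C]_(N * N)) s s' :
  (mx_expr M : 'M[expr]_(N * N)) s s' = (M s s')%:A.
Proof. by rewrite mxE. Qed.

Lemma sconst_mxE s s' : map_mx (@sconst C) R s s' = sconst (R s s').
Proof. by rewrite mxE. Qed.

Lemma braiding_shift : Ruv = R12 - (pole t)%:P%:A%:M.
Proof. by apply/matrixP => s s'; rewrite !mxE /= scalerBl scalerMnl. Qed.

Lemma xcol2E y z a b s :
  xcol2 y z (mxtens_index (a, b)) s = xlo a y * xlo b z.
Proof. by rewrite mxE mxtens_indexK. Qed.

Lemma xrow2E y z k l s :
  xrow2 y z s (mxtens_index (k, l)) = xup l y * xup k z.
Proof. by rewrite mxE mxtens_indexK. Qed.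

Lemma braiding_col2 : Ruv *m xcol2 u v ~~~ g%:A *: xcol2 v u.
Proof.
apply: mx_congr_sym => s z; case: (mxtens_indexP s) => i j.
rewrite mxE xcol2E mulr_algl mxE sum_mxtens.
under eq_bigr do under eq_bigr do rewrite mx_exprE xcol2E mulr_algl.
exact: ideal_rel (rel_lower t R i j).
Qed.

Lemma row2_braiding : xrow2 v u *m Ruv ~~~ g%:A *: xrow2 u v.
Proof.
apply: mx_congr_sym => z s; case: (mxtens_indexP s) => k l.
(* The relation sums over the second index of the pair first. *)
rewrite mxE xrow2E mulr_algl mxE sum_mxtens exchange_big /=.
under eq_bigr do under eq_bigr do rewrite mx_exprE xrow2E mulr_algr.
exact: ideal_rel (rel_upper t R l k).
Qed.

(** The two points may be taken in either order: the delta term then carries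
    x_a(y) x^k(z), which the rules for delta turn into l_a^k(u) both times. *)
Lemma L1_R_L1 y z : (y, z) = (u, v) \/ (y, z) = (v, u) ->
  L1 N y *m R12 *m L1 N z
    ~~~ (sconst (qparam t)^-1)%:A *: (xcol2 y z *m xrow2 y z)
        + (delta C)%:A *: L1 N u.
Proof.
move=> yz s s'; case: (mxtens_indexP s) => a b; case: (mxtens_indexP s') => k l.
have Gdelta : ideal_gen (zf_relator t R)
    (delta C *: (xlo a y * xup k z) - delta C *: Lmx N u a k).
  apply: ideal_rel.
  by case: yz => -[-> ->]; [exact: rel_delta_uv|exact: rel_delta_vu].
have Gmixed := ideal_mul (xlo a y) (xup k z) (ideal_rel (rel_mixed t R b l yz)).
have Gdelta' := ideal_mull (b == l)%:R Gdelta.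
(* The sum over c and e is the left-hand side of the mixed relation (b, l). *)
have inner :
    (L1 N y *m R12 *m L1 N z) (mxtens_index (a, b)) (mxtens_index (k, l))
  = xlo a y * (\sum_c \sum_e sconst (tentry R c b e l) *: (xup c y * xlo e z))
    * xup k z.
  rewrite /L1 mul_mx_leg1 exchange_big mulr_sumr mulr_suml.
  apply: eq_bigr => e _; rewrite mul_leg1_mx mulr_sumr !mulr_suml.
  apply: eq_bigr => c _; rewrite mx_exprE sconst_mxE.
  by apply: scale_inner; rewrite mxE.
have outer :
    ((sconst (qparam t)^-1)%:A *: (xcol2 y z *m xrow2 y z)
      + (delta C)%:A *: L1 N u) (mxtens_index (a, b)) (mxtens_index (k, l))
  = sconst (qparam t)^-1 *: (xlo a y * (xlo b z * xup l y) * xup k z)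
    + (b == l)%:R * (delta C *: Lmx N u a k).
  rewrite mxE [X in X + _]mxE [X in _ + X]mxE !mulr_algl /L1 tensmxE.
  rewrite mxE big_ord1 xcol2E xrow2E !mulrA; congr (_ + _).
  rewrite [_%:M _ _]mxE; case: (b == l); first by rewrite mulr1 mul1r.
  by rewrite mulr0 mul0r scaler0.
have := ideal_add Gmixed Gdelta'; rewrite inner outer; congr (ideal_gen _ _).
exact: contract_inner.
Qed.

End ReflectionEquation.

Theorem proposition10 (K : realType) (N : nat) (t : current_type K[i])
    (R : 'M[K[i]]_(N * N)) :
  symmetry_of t R -> skew_invertible R ->
  let u := ru K[i] in
  let v := rv K[i] in
  let Ruv := mx_expr (current_braiding t R) in
  let R12 := mx_expr (map_mx (@sconst K[i]) R) in
  mx_congr (zf_relator t R)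
    (Ruv *m L1 N u *m R12 *m L1 N v - L1 N v *m R12 *m L1 N u *m Ruv)
    ((delta K[i])%:A *: (R12 *m L1 N u - L1 N u *m R12)).
Proof.
move=> _ _ u v Ruv R12.
exact: reflection_of_exchange (braiding_shift t R)
  (L1_R_L1 t R (or_introl erefl)) (L1_R_L1 t R (or_intror erefl))
  (braiding_col2 t R) (row2_braiding t R).
Qed.
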